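(* For $n\ge 0$ let $H_n$ be the $n\times n$ Hankel matrix with entries $(H_n)_{i,j}=f(i+j-2)$ for $1\le i,j\le n$, where $f(m)$ is the number of lattice paths from $(0,0)$ to $(m,0)$ that never run below the $x$-axis and use the steps $U=(1,1)$, $H=(3,0)$, $D=(1,-1)$. Then $$(\det(H_n))_{n=1}^{14}=(1,1,0,0,-1,-1,-1,-1,-1,0,0,1,1,1).$$ Moreover, if $m,n\ge 0$ and $n-m\equiv 0 \pmod{14}$, then $\det(H_m)=\det(H_n)$.
   Context: The path of length zero is counted, so $f(0)=1$. Equivalently, $F(x)=\sum_{m\ge0}f(m)x^m$ satisfies $F(x)=1+x^3F(x)+x^2F(x)^2$; the sequence begins $1,0,1,1,2,3,6,10,20,36,\ldots$. The determinant of the $0\times 0$ matrix is $1$. *)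

(* Defs.v *)
From HB Require Import structures.
From mathcomp Require Import all_boot all_order all_algebra.
Set Implicit Arguments.
Unset Strict Implicit.
Unset Printing Implicit Defensive.
Import Order.TTheory GRing.Theory Num.Theory.
Local Open Scope ring_scope.

Inductive step := U | H | D.

Definition option_bool_of_step (s : step) : option bool :=
  match s with U => Some true | D => Some false | H => None end.
Definition step_of_option_bool (o : option bool) : step :=
  match o with Some true => U | Some false => D | None => H end.
Lemma option_bool_of_stepK : cancel option_bool_of_step step_of_option_bool.
Proof. by case. Qed.
HB.instance Definition _ := Finite.copy step (can_type option_bool_of_stepK).

Definition step_vec (s : step) : int * int :=
  match s with U => (1, 1) | H => (3, 0) | D => (1, -1) end.

(* The lattice points visited after each step, starting from the origin,
   which is itself not listed. *)
Definition vertices (w : seq step) : seq (int * int) :=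
  scanl (fun p s => p + step_vec s) 0 w.

(* Steps are straight segments, so a path stays weakly above the x-axis as soon
   as its vertices do. *)
Definition is_path (m : nat) (w : seq step) : bool :=
  (last 0 (vertices w) == (m%:Z, 0)) &&
  all (fun p : int * int => 0 <= p.2) (vertices w).

(* Every step moves at least one unit to the right, so a path to (m, 0) has at
   most m steps: counting in m.-bseq step counts all of them. *)
Definition f (m : nat) : nat := #|[set w : m.-bseq step | is_path m w]|.

(* Rows and columns are indexed from 0, hence i + j in place of i + j - 2. *)
Definition hankel (n : nat) : 'M[int]_n := \matrix_(i < n, j < n) (f (i + j))%:Z.

(* Main.v *)
Require Import Defs.
From HB Require Import structures.
From mathcomp Require Import all_boot all_order all_algebra.
From mathcomp Require Import zify ring.
Set Implicit Arguments.
Unset Strict Implicit.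
Unset Printing Implicit Defensive.
Import Order.TTheory GRing.Theory Num.Theory.
Local Open Scope ring_scope.

(** Write H_n(p) for the Hankel determinant of order n of a power series p.
The proof expands F as a continued fraction and finds it periodic.

If u is a power series with u(0) = 1 and u p = x^e, split it as
u = a - x^(e+2) q with a a polynomial of degree at most e + 1.  Multiplying the
Hankel matrix of p on both sides by the unitriangular Toeplitz matrix of u
turns it into a block diagonal matrix: an antitriangular block of order e + 1
with ones on its antidiagonal, and the Hankel matrix of q.  Hence
H_(e+1+n)(p) = (-1)^C(e+1,2) H_n(q) ([hankel_det_step]), while
H_n(p) = 0 for 0 < n <= e ([hankel_det_gap]).

The equation F = 1 + x^3 F + x^2 F^2 makes the reciprocal of a linear
expression in F its conjugate divided by its norm, and the norms that occur
below are 1 and 1 + x up to powers of x.  So only 1 + x has to be inverted, and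
the expansion closes up after five steps,

  F  ->  F + x  ->  (F - 1)/(1 + x)  ->  x F + F^2  ->  (F + x)/(1 + x)  ->  F,

with e = 0, 0, 2, 0, 0 ([hankel_det_chain]).  The orders consumed add up to
1 + 1 + 3 + 1 + 1 = 7 and the only sign comes from C(3,2) = 3, so that
H_(n+7)(F) = - H_n(F), and H_n(F) has period 14.  The gap before the third step
gives the two zeros, and the chain gives the other values of order below 7.

Power series are handled as polynomials modulo x^N with N large, each congruence
being an equation with an explicit multiple of x^N.

That F has the numbers f(m) as coefficients is obtained without decomposing
paths at their returns to the axis: paths from height h down to the axis satisfy
a linear recurrence on their first step, and the coefficients of x^h F^(h+1)
satisfy the same one ([size_paths]). *)

(** * One step of the continued fraction on Hankel determinants *)

Definition hankel_det (R : comNzRingType) (n : nat) (p : {poly R}) : R :=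
  \det (\matrix_(i < n, j < n) p`_(i + j)).

Definition toeplitz (R : comNzRingType) (n : nat) (u : {poly R}) : 'M[R]_n :=
  \matrix_(i < n, j < n) (if (j <= i)%N then u`_(i - j) else 0).

Lemma det_toeplitz (R : comNzRingType) (n : nat) (u : {poly R}) :
  u`_0 = 1 -> \det (toeplitz n u) = 1.
Proof.
move=> u0; rewrite det_trig; last first.
  by apply/is_trig_mxP => i j ltij; rewrite mxE leqNgt ltij.
by rewrite big1 // => i _; rewrite mxE leqnn subnn.
Qed.

(** The coefficient of x^i y^j in u(x) u(y) (x p(x) - y p(y)) / (x - y); the
quotient is the generating function of the Hankel matrix of p. *)
Definition twist (R : comNzRingType) (u p : {poly R}) (i j : nat) : R :=
  \sum_(k < i.+1) \sum_(l < j.+1) u`_(i - k) * u`_(j - l) * p`_(k + l).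

Lemma toeplitz_hankel (R : comNzRingType) (n : nat) (u p : {poly R}) :
  toeplitz n u *m (\matrix_(i, j) p`_(i + j)) *m (toeplitz n u)^T
    = \matrix_(i, j) twist u p i j.
Proof.
apply/matrixP => i j; rewrite !mxE.
under eq_bigr => l _.
  rewrite !mxE big_distrl /=.
  under eq_bigr => k _ do rewrite !mxE.
  over.
rewrite exchange_big /= /twist.
rewrite (big_ord_widen n
  (fun k => \sum_(l < j.+1) u`_(i - k) * u`_(j - l) * p`_(k + l))) //.
rewrite [RHS]big_mkcond /=; apply: eq_bigr => k _; rewrite ltnS.
case: leqP => ki; last by rewrite big1 // => l _; rewrite !mul0r.
rewrite (big_ord_widen n (fun l => u`_(i - k) * u`_(j - l) * p`_(k + l))) //.
rewrite [RHS]big_mkcond /=; apply: eq_bigr => l _; rewrite ltnS.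
by case: leqP => lj; [rewrite mulrAC | rewrite mulr0].
Qed.

Lemma twistC (R : comNzRingType) (u p : {poly R}) (i j : nat) :
  twist u p i j = twist u p j i.
Proof.
rewrite /twist exchange_big; apply: eq_bigr => k _; apply: eq_bigr => l _.
by rewrite addnC (mulrC u`_(i - l)).
Qed.

Lemma twist0n (R : comNzRingType) (u p : {poly R}) (j : nat) :
  twist u p 0 j = u`_0 * (u * p)`_j.
Proof.
rewrite /twist big_ord1 coefMr mulr_sumr.
by apply: eq_bigr => l _; rewrite mulrA.
Qed.

Lemma twistSn (R : comNzRingType) (u p : {poly R}) (i j : nat) :
  twist u p i.+1 j = u`_i.+1 * (u * p)`_j
     + \sum_(k < i.+1) \sum_(l < j.+1) u`_(i - k) * u`_(j - l) * p`_(k + l).+1.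
Proof.
rewrite /twist big_ord_recl; congr (_ + _).
by rewrite coefMr mulr_sumr; apply: eq_bigr => l _; rewrite mulrA.
Qed.

(** Multiplication by x - y removes the denominator of the generating function:
this recurrence determines [twist u p] from u and u p alone, given its row 0. *)
Lemma twist_exchange (R : comNzRingType) (u p : {poly R}) (i j : nat) :
  twist u p i.+1 j =
    twist u p i j.+1 + u`_i.+1 * (u * p)`_j - u`_j.+1 * (u * p)`_i.
Proof.
rewrite (twistC u p i) !twistSn exchange_big /=.
under [X in _ = _ + X + _ - _]eq_bigr => k _ do
  under eq_bigr => l _ do rewrite (mulrC u`_(j - k)) addnC.
by ring.
Qed.

(** The coefficients of (x^(e+1) u(y) - y^(e+1) u(x)) / (x - y), which is what
the generating function of [twist u p] becomes when u p = x^e.  For a monomial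
c x^k of u the quotient is c times the sum of the x^i y^j with i + j = e + k,
where k <= i, j <= e if k <= e, and minus the sum with e < i, j < k if
k > e + 1. *)
Definition block_entry (R : comNzRingType) (u : {poly R}) (e i j : nat) : R :=
  if (i <= e)%N && (j <= e)%N then if (e <= i + j)%N then u`_(i + j - e) else 0
  else if (e < i)%N && (e < j)%N then - u`_(i + j - e)
  else 0.

Lemma twistE (R : comNzRingType) (u p r : {poly R}) (N e i j : nat) :
    u`_0 = 1 -> u * p = 'X^e + r * 'X^N -> (i + j < N)%N ->
  twist u p i j = block_entry u e i j.
Proof.
move=> u0 up; have w k : (k < N)%N -> (u * p)`_k = (k == e)%:R.
  by move=> kN; rewrite up coefD coefMXn coefXn kN addr0.
elim: i j => [|i IH] j ijN.
  rewrite twist0n w // u0 mul1r /block_entry ltn0 leq0n add0n.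
  by case: ltngtP => // ->; rewrite subnn u0.
rewrite twist_exchange IH ?addnS -?addSn // !w; [|lia..].
have addSKl b c : ((b + c).+1 - b = c.+1)%N by lia.
have addSKr b c : ((c + b).+1 - b = c.+1)%N by lia.
rewrite /block_entry !addSn.
case: (ltngtP i e) => hi; case: (ltngtP j e) => hj;
  rewrite ?mulr0 ?mulr1 ?subr0 ?addr0 ?sub0r /=;
  do ?[case: ifP => ?]; try lia;
  subst; by rewrite ?addnS ?addSKl ?addSKr ?add0r ?addNr ?subrr.
Qed.

Lemma hankel_det_block (R : comNzRingType) (u p r : {poly R}) (N e n : nat) :
    u`_0 = 1 -> u * p = 'X^e + r * 'X^N -> (n.*2 <= N)%N ->
  hankel_det n p = \det (\matrix_(i < n, j < n) block_entry u e i j).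
Proof.
move=> u0 up leN; have -> : hankel_det n p =
    \det (toeplitz n u *m (\matrix_(i, j) p`_(i + j)) *m (toeplitz n u)^T).
  by rewrite !det_mulmx det_tr det_toeplitz // mul1r mulr1.
rewrite toeplitz_hankel; congr (\det _); apply/matrixP => i j.
rewrite !mxE (twistE u0 up) //.
by have := ltn_ord i; have := ltn_ord j; lia.
Qed.

(** Row 0 of the block is concentrated in its last column, and the
complementary minor is the block of order one less. *)
Lemma det_antitriangular (R : comNzRingType) (u : {poly R}) (e : nat) :
    u`_0 = 1 ->
  \det (\matrix_(i < e.+1, j < e.+1) block_entry u e i j) = (-1) ^+ 'C(e.+1, 2).
Proof.
move=> u0; elim: e => [|e IH].
  by rewrite det_mx11 mxE /block_entry /= u0.
rewrite (expand_det_row _ ord0) big_ord_recr big1 /=; last first.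
  move=> j _; rewrite mxE /block_entry /=; have := ltn_ord j.
  case: ifP => [|/negbT]; try lia.
  by case: ifP; rewrite ?mul0r //; lia.
rewrite add0r mxE {1}/block_entry /= add0n !ltnSn subnn u0 mul1r /cofactor.
rewrite binS bin1 [RHS]exprD [RHS]mulrC /=; congr (_ * _); rewrite -IH.
congr (\det _); apply/matrixP => i j; rewrite !mxE /= /bump /=.
have hi := ltn_ord i; have hj := ltn_ord j.
rewrite leqNgt hj add0n add1n /block_entry.
have -> : (i < e.+1)%N by lia.
have -> : (j <= e.+1)%N by lia.
have -> : (i <= e)%N by lia.
have -> : (j <= e)%N by lia.
by rewrite addSn ltnS subSS.
Qed.

(** Only the coefficients of u = a - x^(e+2) q of degree above e + 1 enter the
lower block: its entry (i, j) is minus the one of degree e + 2 + i + j, which is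
the coefficient of degree i + j of q. *)
Lemma hankel_det_step (R : comNzRingType) (a p q r : {poly R}) (N e n : nat) :
    a`_0 = 1 -> (size a <= e.+2)%N ->
    (a - 'X^(e.+2) * q) * p = 'X^e + r * 'X^N -> ((e.+1 + n).*2 <= N)%N ->
  hankel_det (e.+1 + n) p = (-1) ^+ 'C(e.+1, 2) * hankel_det n q.
Proof.
move=> a0 sa up leN; set u := a - _ in up.
have u0 : u`_0 = 1 by rewrite coefB coefXnM a0 subr0.
rewrite (hankel_det_block u0 up leN) -(det_antitriangular _ u0).
rewrite -(@det_ublock _ _ _ _ 0); congr (\det _); apply/matrixP => i j.
rewrite !mxE; case: splitP => i' ->; rewrite !mxE; case: splitP => j' ->;
  rewrite !mxE // /block_entry; have hi := ltn_ord i'; have hj := ltn_ord j'.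
- by do ![case: ifP => // ?]; lia.
- by do ![case: ifP => // ?]; lia.
do ![case: ifP => ?]; try lia.
have -> : (e.+1 + i' + (e.+1 + j') - e = e.+2 + (i' + j'))%N by lia.
rewrite /u coefB coefXnM ltnNge leq_addr /= addKn.
by rewrite nth_default ?sub0r ?opprK // (leq_trans sa) // leq_addr.
Qed.

(** Below order e + 1 the antidiagonal of ones is cut off, and row 0 of the
reduced matrix vanishes. *)
Lemma hankel_det_gap (R : comNzRingType) (u p r : {poly R}) (N e n : nat) :
    u`_0 = 1 -> u * p = 'X^e + r * 'X^N -> (n.*2 <= N)%N -> (0 < n <= e)%N ->
  hankel_det n p = 0.
Proof.
move=> u0 up leN; case: n leN => // n leN /= ne.
rewrite (hankel_det_block u0 up leN) (expand_det_row _ ord0) big1 // => j _.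
rewrite mxE /block_entry /=; have := ltn_ord j => hj.
by do ![case: ifP => ?]; rewrite ?mul0r //; lia.
Qed.

(** * Counting paths *)

Definition gf_step (p : {poly int}) : {poly int} :=
  1 + 'X^3 * p + 'X^2 * p ^+ 2.

Definition path_gf (N : nat) : {poly int} := iter N gf_step 0.

(** [gf_step p - gf_step q] is divisible by x^2 (p - q), so that each iteration
makes more coefficients stationary. *)
Lemma path_gf_fixpoint (N : nat) :
  exists r, gf_step (path_gf N) = path_gf N + r * 'X^N.
Proof.
elim: N => [|N [r IH]]; first by exists (gf_step 0); rewrite expr0 mulr1 add0r.
set p := path_gf N in IH *.
exists (r * ('X^2 + 'X * (p + gf_step p))).
have subE : gf_step p - p = r * 'X^N by rewrite IH addrC addKr.
have -> : path_gf N.+1 = gf_step p by [].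
have stepB q : gf_step q = gf_step p + (q - p) * ('X^3 + 'X^2 * (p + q)).
  by rewrite /gf_step; ring.
by rewrite stepB subE (exprS _ N); ring.
Qed.

(** The words with fewer than k letters that lead from height h to height 0 over
a horizontal distance m without going below the axis, sorted by first letter; k
is the fuel of the recursion. *)
Fixpoint paths (k m h : nat) : seq (seq step) :=
  if k is k'.+1 then
    (if (m == 0)%N && (h == 0)%N then [:: [::]] else [::])
    ++ (if m is m1.+1 then map (cons U) (paths k' m1 h.+1) else [::])
    ++ (if (m, h) is (m1.+1, h1.+1) then map (cons D) (paths k' m1 h1) else [::])
    ++ (if m is m3.+3 then map (cons H) (paths k' m3 h) else [::])
  else [::].

Lemma mem_map_cons (s t : step) (w : seq step) (ws : seq (seq step)) :
  (s :: w \in map (cons t) ws) = (s == t) && (w \in ws).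
Proof.
apply/mapP/andP => [[v vin [-> ->]]|[/eqP-> win]]; first by rewrite eqxx.
by exists w.
Qed.

Lemma nil_map_cons (t : step) (ws : seq (seq step)) :
  ([::] \in map (cons t) ws) = false.
Proof. by apply/mapP => -[]. Qed.

Definition visited (p : int * int) (w : seq step) : seq (int * int) :=
  scanl (fun p s => p + step_vec s) p w.

(** [is_path] with an arbitrary starting point, as needed to induct on the first
step. *)
Definition reaches (m : nat) (p : int * int) (w : seq step) : bool :=
  (last p (visited p w) == (p.1 + m%:Z, 0)) &&
  all (fun q : int * int => 0 <= q.2) (visited p w).

Lemma last_visited_ge (p : int * int) (w : seq step) :
  p.1 <= (last p (visited p w)).1.
Proof.
elim: w p => //= s w IH p; apply: le_trans (IH _).
by case: p s => x y [] /=; lia.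
Qed.

Lemma reaches_cons (m m' : nat) (p : int * int) (s : step) (w : seq step) :
    m%:Z = (step_vec s).1 + m'%:Z ->
  reaches m p (s :: w) =
    (0 <= (p + step_vec s).2) && reaches m' (p + step_vec s) w.
Proof. by move=> mE; rewrite /reaches /= mE addrA andbCA. Qed.

(** No step goes left, so a step longer than the distance left to cover cannot
be compensated. *)
Lemma reaches_overshoot (m : nat) (p : int * int) (s : step) (w : seq step) :
  m%:Z < (step_vec s).1 -> reaches m p (s :: w) = false.
Proof.
move=> ms; rewrite /reaches /=; case: eqP => //= lastE.
by have := last_visited_ge (p + step_vec s) w; rewrite lastE /=; lia.
Qed.

Lemma mem_paths (k m h : nat) (x : int) (w : seq step) :
  (w \in paths k m h) = (size w < k)%N && reaches m (x, h%:Z) w.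
Proof.
elim: k m h x w => [|k IH] m h x w //=.
rewrite !mem_cat; case: w => [|s w].
  have -> : reaches m (x, h%:Z) [::] = (m == 0)%N && (h == 0)%N.
    by rewrite /reaches /= andbT xpair_eqE /=; congr (_ && _); lia.
  by case: m => [|[|[|m]]]; case: h => [|h] //=; rewrite ?nil_map_cons.
have not_nil :
    (s :: w \in if (m == 0)%N && (h == 0)%N then [:: [::]] else [::]) = false.
  by case: ifP.
rewrite not_nil /= ltnS; case: s {not_nil}.
- case: m => [|m]; first by rewrite reaches_overshoot // andbF.
  rewrite (@reaches_cons _ m) // mem_map_cons (IH m _ (x + 1)).
  have -> : (x, h%:Z) + step_vec U = (x + 1, h.+1%:Z).
    by congr (_, _); rewrite intS [RHS]addrC.
  by case: h => [|h]; case: m => [|[|m]]; rewrite ?mem_map_cons ?orbF //= orbF.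
- case: m => [|[|[|m]]]; do ?[by rewrite reaches_overshoot //
    andbF; case: h => [|h]; rewrite //= ?mem_map_cons].
  rewrite (@reaches_cons _ m) // !mem_map_cons (IH m h (x + 3)).
  have -> : (x, h%:Z) + step_vec H = (x + 3, h%:Z) by congr (_, _); exact: addr0.
  by case: h => [|h]; rewrite ?mem_map_cons.
case: m => [|m]; first by rewrite reaches_overshoot // andbF.
rewrite (@reaches_cons _ m) // mem_map_cons.
have no_H : (D :: w \in
    if m is m3.+2 then map (cons H) (paths k m3 h) else [::]) = false.
  by case: m => [|[|m]]; rewrite ?mem_map_cons.
case: h no_H => [|h] no_H.
  by rewrite no_H andbF.
rewrite mem_map_cons (IH m h (x + 1)).
have -> : (x, h.+1%:Z) + step_vec D = (x + 1, h%:Z).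
  by congr (_, _); rewrite /=; lia.
by rewrite no_H orbF.
Qed.

Lemma uniq_paths (k m h : nat) : uniq (paths k m h).
Proof.
have consI s : injective (cons (s : step)) by move=> ? ? [].
have no_overlap s t ws ws' : s != t ->
    has (mem (map (cons s) ws)) (map (cons t) ws') = false.
  move=> st; apply/hasP => -[_ /mapP[w _ ->]] /mapP[w' _ [ts]].
  by rewrite ts eqxx in st.
have no_nil t ws : has (mem [:: [::]]) (map (cons t) ws) = false.
  by apply/hasP => -[_ /mapP[w _ ->]].
elim: k m h => [|k IH] [|[|[|m]]] [|h] //=;
  by rewrite ?cat_uniq ?has_cat ?no_overlap ?no_nil
    ?(map_inj_uniq (consI _)) ?IH.
Qed.

Lemma f_paths (m : nat) : f m = size (paths m.+1 m 0).
Proof.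
rewrite /f cardE -(size_map val); apply: perm_size; apply: uniq_perm.
- by rewrite (map_inj_uniq val_inj) enum_uniq.
- exact: uniq_paths.
move=> w; rewrite (mem_paths _ _ _ 0) ltnS.
apply/mapP/andP => [[v + ->]|[wm ok]].
  rewrite mem_enum inE => ok; split; first exact: size_bseq.
  by rewrite /reaches add0r.
exists (Bseq wm) => //; rewrite mem_enum inE.
by move: ok; rewrite /reaches add0r.
Qed.

(** The series G_h = x^h F^(h+1) satisfy
G_h = [h = 0] + x G_(h+1) + [h > 0] x G_(h-1) + x^3 G_h, which is F^h x^h times
the equation of F, and the same recurrence is the sorting of paths by first
step. *)
Lemma size_paths (N k m h : nat) : (m < k)%N -> (m < N)%N ->
  (size (paths k m h))%:Z = ('X^h * path_gf N ^+ h.+1)`_m.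
Proof.
have [r gfE] := path_gf_fixpoint N; set F := path_gf N in gfE *.
have stepE h' : F ^+ h'.+1 =
    F ^+ h' * (1 + 'X^3 * F + 'X^2 * F ^+ 2) - r * F ^+ h' * 'X^N.
  by rewrite -/(gf_step F) gfE exprS; ring.
elim: k m h => // k IH m h mk mN.
rewrite /= !size_cat !PoszD.
have -> : 'X^h * F ^+ h.+1 = 'X^h * F ^+ h + 'X * ('X^(h.+1) * F ^+ h.+2)
    + 'X^3 * ('X^h * F ^+ h.+1) + - ('X^h * r * F ^+ h) * 'X^N.
  by rewrite {1}stepE !exprS; ring.
rewrite !coefD coefMXn mN addr0 coefXM.
(* For h = 0 this term is the constant 1, the empty path; for h > 0 it is
   x G_(h-1), the paths that start with D. *)
have baseE :
    (if h is h'.+1 then if m is m'.+1 then (size (paths k m' h'))%:Z else 0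
     else (m == 0)%:R) = ('X^h * F ^+ h)`_m.
  case: h => [|h]; first by rewrite mul1r coef1.
  rewrite exprS -mulrA coefXM; case: m mk mN => //= m mk mN.
  by rewrite IH // ltnW.
rewrite -baseE (coefXnM 3).
case: m mk mN {baseE} => [|m] mk mN /=; first by case: h.
rewrite -IH ?(ltnW mN) //.
case: m mk mN => [|[|m]] mk mN; rewrite /= ?size_map ?add0r ?addr0.
- by rewrite addrC; case: h => [|h] /=; rewrite ?size_map.
- by rewrite addrC; case: h => [|h] /=; rewrite ?size_map.
rewrite !subSS subn0 -IH; [|lia..].
by rewrite addrCA addrA; case: h => [|h] /=; rewrite ?size_map.
Qed.

Lemma f_path_gf (N m : nat) : (m < N)%N -> (f m)%:Z = (path_gf N)`_m.
Proof. by move=> mN; rewrite f_paths (size_paths 0 _ mN) // mul1r. Qed.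

Lemma det_hankelE (N n : nat) :
  (n.*2 <= N)%N -> \det (hankel n) = hankel_det n (path_gf N).
Proof.
move=> nN; congr (\det _); apply/matrixP => i j; rewrite !mxE.
by apply: f_path_gf; have := ltn_ord i; have := ltn_ord j; lia.
Qed.

(** * The periodic expansion *)

Lemma inv_1addX_mod (R : comNzRingType) (N : nat) :
  exists J r : {poly R}, (1 + 'X) * J = 1 + r * 'X^N.
Proof.
exists (\sum_(i < N) (- 'X) ^+ i), (- (-1) ^+ N).
by rewrite mulNr -exprNn -[LHS]opprK -mulNr opprD [- 1 - 'X]addrC -subrX1 opprB.
Qed.

(** The four intermediate series are F + x, (F - 1)/(1 + x), x F + F^2 and
(F + x)/(1 + x).  Five identities u p = x^e carry the chain.  The first is
the equation of F; the others reduce to (F + x)(1 - x^2 F) = 1 + x and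
(F - 1)(1 - x^2 - x^3 - x^2 F) = x^2 + x^3. *)
Lemma hankel_det_chain (R : comNzRingType) (N : nat) (F a : {poly R}) :
    1 + 'X^3 * F + 'X^2 * F ^+ 2 = F + a * 'X^N ->
  exists p1 p2 p3 p4 : {poly R},
    [/\ forall n, (n.+1.*2 <= N)%N -> hankel_det n.+1 F = hankel_det n p1,
        forall n, (n.+1.*2 <= N)%N -> hankel_det n.+1 p1 = hankel_det n p2,
        (forall n, (n.+3.*2 <= N)%N -> hankel_det n.+3 p2 = - hankel_det n p3)
          /\ (forall n, (0 < n <= 2)%N -> (n.*2 <= N)%N -> hankel_det n p2 = 0),
        forall n, (n.+1.*2 <= N)%N -> hankel_det n.+1 p3 = hankel_det n p4
      & forall n, (n.+1.*2 <= N)%N -> hankel_det n.+1 p4 = hankel_det n F].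
Proof.
move=> FE; have [J [b JE]] := inv_1addX_mod R N.
have aE : a * 'X^N = 1 + 'X^3 * F + 'X^2 * F ^+ 2 - F by rewrite FE addrC addKr.
have bE : b * 'X^N = (1 + 'X) * J - 1 by rewrite JE addrC addKr.
have size1 : (size (1 : {poly R})%R <= 2)%N by rewrite size_poly1.
have size1X : (size (1 - 'X : {poly R})%R <= 2)%N.
  by rewrite -opprB size_polyN size_XsubC.
(* The part of degree at most 3 of x^2 (1 + x) / (F - 1)
   = 1 - x^2 - x^3 - x^2 F, where F = 1 + x^2 (x F + F^2). *)
pose alpha : {poly R} := 1 - 2%:R * 'X^2 - 'X^3.
have alpha0 : alpha`_0 = 1.
  by rewrite /alpha !coefB coef1 mulr_natl coefMn !coefXn /= mul0rn !subr0.
have size_alpha : (size alpha <= 4)%N.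
  apply/leq_sizeP => j j4; rewrite /alpha !coefB coef1 mulr_natl coefMn !coefXn.
  by case: j j4 => [|[|[|[|j]]]] //= _; rewrite mul0rn !subr0.
have one0 : (1 : {poly R})`_0 = 1 by rewrite coef1.
have oneX0 : (1 - 'X : {poly R})`_0 = 1 by rewrite coefB coef1 coefX subr0.
(* The errors a x^N in the equation of F and b x^N in (1 + x) J = 1 propagate
   with the cofactors by which these equations enter each identity. *)
have eq0 : (1 - 'X^2 * (F + 'X)) * F = 'X^0 + (- a) * 'X^N.
  by rewrite mulNr aE; ring.
have eq1 : (1 - 'X - 'X^2 * (J * (F - 1))) * (F + 'X) =
    'X^0 + (b * (1 - (1 - 'X) * (F + 'X)) - a * J) * 'X^N.
  by rewrite [in RHS]mulrBl (mulrAC b) (mulrAC a) aE bE; ring.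
have eq2 : (alpha - 'X^4 * ('X * F + F ^+ 2)) * (J * (F - 1)) =
    'X^2 + (b * 'X^2 - a * (J + 'X^2 * J * (F - 1))) * 'X^N.
  by rewrite [in RHS]mulrBl (mulrAC b) (mulrAC a) aE bE /alpha; ring.
have eq3 : (1 - 'X - 'X^2 * (J * (F + 'X))) * ('X * F + F ^+ 2) =
    'X^0 + (b * (1 - (1 - 'X) * ('X * F + F ^+ 2)) - a * (J * (1 + 'X + F)))
             * 'X^N.
  by rewrite [in RHS]mulrBl (mulrAC b) (mulrAC a) aE bE; ring.
have eq4 : (1 - 'X^2 * F) * (J * (F + 'X)) = 'X^0 + (b - a * J) * 'X^N.
  by rewrite [in RHS]mulrBl (mulrAC a) aE bE; ring.
exists (F + 'X), (J * (F - 1)), ('X * F + F ^+ 2), (J * (F + 'X)).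
split=> [n nN|n nN||n nN|n nN].
- by rewrite (@hankel_det_step _ _ _ _ _ N 0 n one0 size1 eq0) // mul1r.
- by rewrite (@hankel_det_step _ _ _ _ _ N 0 n oneX0 size1X eq1) // mul1r.
- split=> [n nN|n n2 nN].
    rewrite (@hankel_det_step _ _ _ _ _ N 2 n alpha0 size_alpha eq2) //.
    by rewrite -signr_odd mulN1r.
  apply: (hankel_det_gap _ eq2 nN n2).
  by rewrite coefB coefXnM subr0.
- by rewrite (@hankel_det_step _ _ _ _ _ N 0 n oneX0 size1X eq3) // mul1r.
by rewrite (@hankel_det_step _ _ _ _ _ N 0 n one0 size1 eq4) // mul1r.
Qed.

(** One turn of the chain consumes order 7 and produces one sign. *)
Lemma det_hankel_antiperiodic (n : nat) :
  \det (hankel n.+4.+3) = - \det (hankel n).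
Proof.
have [a FE] := path_gf_fixpoint (n.+4.+3).*2.
have [p1 [p2 [p3 [p4 [E0 E1 [E2 _] E3 E4]]]]] := hankel_det_chain FE.
rewrite !(@det_hankelE (n.+4.+3).*2) //; last by lia.
by rewrite E0 // E1 ?E2 ?E3 ?E4 //; lia.
Qed.

(** Each of these orders runs down the chain either to order 0, where the
determinant is 1, or into the gap at (F - 1)/(1 + x), for orders 3 and 4.
Truncating at x^12 is harmless, as a Hankel matrix of order at most 6 has no
coefficient of index above 10. *)
Lemma det_hankel_lt7 :
  [seq \det (hankel n) | n <- iota 0 7] = [:: 1; 1; 1; 0; 0; -1; -1] :> seq int.
Proof.
have [a FE] := path_gf_fixpoint 12.
have [p1 [p2 [p3 [p4 [E0 E1 [E2 gap] E3 _]]]]] := hankel_det_chain FE.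
have det0 p : @hankel_det int 0 p = 1 by rewrite /hankel_det det_mx00.
rewrite /= !(@det_hankelE 12) // !E0 // !E1 // !E2 // !E3 //.
by rewrite !det0 !gap.
Qed.

Theorem proposition1p3 :
  [seq \det (hankel n) | n <- iota 1 14] =
    [:: 1; 1; 0; 0; -1; -1; -1; -1; -1; 0; 0; 1; 1; 1] :> seq int
  /\ (forall m n : nat, (n%:Z - m%:Z = 0 %[mod 14])%Z ->
        \det (hankel m) = \det (hankel n)).
Proof.
split.
  have [E0 E1 E2 E3 E4 E5 E6] := det_hankel_lt7.
  rewrite [LHS]/= !det_hankel_antiperiodic.
  by rewrite E0 E1 E2 E3 E4 E5 E6 !opprK oppr0.
have period k r : \det (hankel (k * 14 + r)) = \det (hankel r).
  by elim: k => // k IH; rewrite mulSn -addnA !det_hankel_antiperiodic opprK.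
move=> m n mn14; rewrite (divn_eq m 14) (divn_eq n 14) !period.
by congr (\det (hankel _)); lia.
Qed.
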